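(* Let $N \geq 2$. There exists a constant $\alpha_N > 0$ depending only on $N$ such that $$\#\left\{ \Gamma \in \mathcal{C}_N : \lambda_N(\Gamma) \leq R,\ \Gamma \text{ is } \mathrm{WR}' \right\} \geq \alpha_N R^N$$ as $R \to \infty$ (i.e., for all sufficiently large real $R$).
   Context: Let $\operatorname{rot}:\mathbb{R}^N\to\mathbb{R}^N$ be the rotational shift operator $\operatorname{rot}(x_1,\dots,x_N)=(x_N,x_1,\dots,x_{N-1})$. A sublattice $\Gamma\subseteq\mathbb{Z}^N$ is called cyclic if $\operatorname{rot}(\Gamma)=\Gamma$. $\mathcal{C}_N$ denotes the set of all full-rank cyclic sublattices of $\mathbb{Z}^N$. For a lattice $\Gamma$ of rank $r$, $\lambda_1(\Gamma)\le\dots\le\lambda_r(\Gamma)$ are its successive minima with respect to the Euclidean norm $\|\cdot\|$, and $S(\Gamma)=\{x\in\Gamma:\|x\|=\lambda_1(\Gamma)\}$ is its set of minimal vectors. $\Gamma$ is called $\mathrm{WR}'$ if $\Gamma=\operatorname{span}_{\mathbb{Z}} S(\Gamma)$. *)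

(* Defs.v *)
From mathcomp Require Import all_boot all_order all_algebra.
From mathcomp Require Import finmap.
From mathcomp Require Import boolp classical_sets functions cardinality reals.

Set Implicit Arguments.
Unset Strict Implicit.
Unset Printing Implicit Defensive.

Import Order.TTheory GRing.Theory Num.Theory.

Local Open Scope classical_set_scope.
Local Open Scope ring_scope.

(* [ord_pred] wraps around, so the entry in position 0 is the last one of [x]. *)
Definition rotv (T : Type) (n : nat) (x : 'rV[T]_n) : 'rV[T]_n :=
  \row_j x ord0 (ord_pred j).

Definition real_mx (R : realType) (m n : nat) (A : 'M[int]_(m, n)) :
  'M[R]_(m, n) := map_mx intr A.

(* The norm that MathComp-Analysis puts on matrices is the sup norm. *)
Definition enorm (R : realType) (n : nat) (x : 'rV[R]_n) : R :=
  Num.sqrt (\sum_(j < n) x ord0 j ^+ 2).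

Definition znorm (R : realType) (n : nat) (x : 'rV[int]_n) : R :=
  enorm (real_mx R x).

Section Lattices.
Variables (R : realType) (n : nat).
Implicit Types (L S : set 'rV[int]_n).

(* Additive subgroups of Z^n; discreteness is automatic. *)
Definition sublattice L : Prop :=
  L 0 /\ (forall x y, L x -> L y -> L (x - y)).

Definition cyclic_lattice L : Prop := [set rotv x | x in L] = L.

(* The rows of [B] are [k] vectors of [L], linearly independent over the
   reals. *)
Definition independent_in L (k : nat) (B : 'M[int]_(k, n)) : Prop :=
  (forall i, L (row i B)) /\ row_free (real_mx R B).

Definition full_rank L : Prop := exists B : 'M[int]_n, independent_in L B.

Definition cyclic_lattices : set (set 'rV[int]_n) :=
  [set L | [/\ sublattice L, full_rank L & cyclic_lattice L]].

(* Indexed from 1. *)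
Definition succ_min (k : nat) L : R :=
  inf [set t : R | 0 <= t /\
    exists B : 'M[int]_(k, n),
      independent_in L B /\ (forall i, znorm R (row i B) <= t)].

Definition min_vectors L : set 'rV[int]_n :=
  [set x | L x /\ znorm R x = succ_min 1 L].

Definition zspan S : set 'rV[int]_n :=
  [set x | exists (k : nat) (c : 'I_k -> int) (v : 'I_k -> 'rV[int]_n),
    (forall i, S (v i)) /\ x = \sum_(i < k) c i *: v i].

Definition WR' L : Prop := L = zspan (min_vectors L).

End Lattices.

(* Main.v *)
(* Take x in Z^N with x_0 >= 5 N t and |x_j| <= t for j <> 0. The matrix of its
   rotations is so strongly diagonally dominant that every integer combination
   other than 0 and plus or minus a single rotation is strictly longer than x.
   Hence the lattice generated by the rotations of x is cyclic, has them (up to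
   sign) as its only minimal vectors, is WR', and determines x, which is the
   only one of those with a large positive entry in position 0. The t^N choices
   of x with x_0 - 5 N t and x_j in [0, t) have norm at most 6 N^2 t. Conversely a
   WR' lattice is spanned by integer vectors of norm at most lambda_N, so there
   are finitely many below any bound. *)
Require Import Defs.
From mathcomp Require Import all_boot all_order all_algebra.
From mathcomp Require Import finmap.
From mathcomp Require Import boolp classical_sets functions cardinality reals.
From mathcomp Require Import ring lra zify.

Set Implicit Arguments.
Unset Strict Implicit.
Unset Printing Implicit Defensive.

Import Order.TTheory GRing.Theory Num.Theory.

Local Open Scope classical_set_scope.
Local Open Scope ring_scope.

(** * Norm bound for diagonally dominant matrices *)

(** With [y = c *m X], expanding [(y_j - m c_j)^2 >= 0] bounds [y_j^2] below by
    [m (2 c_j y_j) - m^2 c_j^2], and each off-diagonal term [2 c_i c_j X_ij] is at least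
    [- t (c_i^2 + c_j^2)]. Stated over any real domain, it serves over the integers for lengths and
    over the reals for independence. *)
Lemma sqr_mulmx_ge (K : realDomainType) (n : nat) (X : 'M[K]_n) (m t : K)
    (c : 'rV_n) :
  0 <= t -> 0 <= m -> (forall i, X i i = m) ->
  (forall i j, i != j -> `|X i j| <= t) ->
  m * (m - (2 * n)%:R * t) * (\sum_i c ord0 i ^+ 2)
    <= \sum_j (c *m X) ord0 j ^+ 2.
Proof.
move=> t0 m0 Xd Xo; set s := \sum_i _.
(* The diagonal term is charged the [t] penalty as well, so that the sum over [i] is uniform. *)
have term i j : (if i == j then 2 * m * c ord0 j ^+ 2 else 0)
    - t * (c ord0 i ^+ 2 + c ord0 j ^+ 2)
    <= 2 * c ord0 j * (c ord0 i * X i j).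
  have [->|ne] := eqVneq i j.
    have := mulr_ge0 t0 (sqr_ge0 (c ord0 j)); rewrite Xd; lra.
  have := Xo _ _ ne; rewrite ler_norml => /andP[X1 X2].
  have := sqr_ge0 (c ord0 j + c ord0 i); have := sqr_ge0 (c ord0 j - c ord0 i).
  move: X1 X2; rewrite -subr_ge0 opprK -[_ <= t]subr_ge0 => X1 X2 sB sD.
  by have := mulr_ge0 X1 sD; have := mulr_ge0 X2 sB; lra.
have row j : 2 * m * c ord0 j ^+ 2 - t * (s + n%:R * c ord0 j ^+ 2)
    <= 2 * c ord0 j * (c *m X) ord0 j.
  rewrite mxE mulr_sumr; apply: le_trans (ler_sum _ (fun i _ => term i j)).
  rewrite sumrB -mulr_sumr big_split /= -/s sumr_const card_ord.
  by rewrite -big_mkcond big_pred1_eq -[c ord0 j ^+ 2 *+ n]mulr_natl.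
have sq j : m ^+ 2 * c ord0 j ^+ 2 - m * t * (s + n%:R * c ord0 j ^+ 2)
    <= (c *m X) ord0 j ^+ 2.
  have := sqr_ge0 ((c *m X) ord0 j - m * c ord0 j).
  have := ler_wpM2l m0 (row j); lra.
apply: le_trans (ler_sum _ (fun j _ => sq j)).
rewrite sumrB -!mulr_sumr big_split /= -mulr_sumr -/s sumr_const card_ord.
rewrite -[s *+ n]mulr_natl natrM; lra.
Qed.

(** * Integer squared norms *)

Definition sqn (n : nat) (x : 'rV[int]_n) : int := \sum_j x ord0 j ^+ 2.

Lemma sqn_ge0 (n : nat) (x : 'rV_n) : 0 <= sqn x.
Proof. by apply: sumr_ge0 => j _; apply: sqr_ge0. Qed.

Lemma znormE (R : realType) (n : nat) (x : 'rV_n) :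
  znorm R x = Num.sqrt (sqn x)%:~R.
Proof.
rewrite /znorm /enorm rmorph_sum; congr Num.sqrt.
by apply: eq_bigr => j _; rewrite mxE rmorphXn.
Qed.

Lemma ler_znorm (R : realType) (n : nat) (x y : 'rV_n) :
  (znorm R x <= znorm R y) = (sqn x <= sqn y).
Proof. by rewrite !znormE ler_psqrt ?nnegrE ?ler0z ?sqn_ge0 // ler_int. Qed.

Lemma znorm_ge0 (R : realType) (n : nat) (x : 'rV_n) : 0 <= znorm R x.
Proof. exact: sqrtr_ge0. Qed.

(** A nonzero integer entry already contributes 1, so all other squares vanish and that entry is 1
    or -1. *)
Lemma sqn_lt2 (n : nat) (c : 'rV_n) :
  sqn c < 2 -> c = 0 \/ exists (b : bool) i, c = (-1) ^+ b *: delta_mx ord0 i.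
Proof.
move=> c2; have [->|/rV0Pn[i ci]] := eqVneq c 0; [by left | right].
have rest0 : 0 <= \sum_(j | j != i) c ord0 j ^+ 2.
  by apply: sumr_ge0 => j _; apply: sqr_ge0.
move: c2; rewrite /sqn (bigD1 i) //= => c2.
have ci1 : 1 <= c ord0 i ^+ 2 by rewrite -gtz0_ge1 exprn_even_gt0 //=.
have rest : \sum_(j | j != i) c ord0 j ^+ 2 = 0.
  by move: rest0 ci1 c2; move: (\sum_(j | _) _) (_ ^+ 2); lia.
exists (c ord0 i < 0), i; apply/rowP => j; rewrite !mxE eqxx /=.
have [->|ji] := eqVneq j i.
  rewrite mulr1; move: c2 ci; rewrite rest addr0 expr2.
  move: (c ord0 i) => u u2 /eqP u0.
  by case: ltP => uN; rewrite /= ?expr1 ?expr0; nia.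
rewrite mulr0; apply/eqP; rewrite -sqrf_eq0; apply/eqP.
by apply: (psumr_eq0P _ rest) => // k _; apply: sqr_ge0.
Qed.

(** * Circulant matrices and dominated vectors *)

(* The rows are the rotations of [x]: index subtraction is modulo [n.+2]. *)
Definition circ (n : nat) (x : 'rV[int]_n.+2) : 'M[int]_n.+2 :=
  \matrix_(i, j) x ord0 (j - i).

Lemma sqn_row_circ (n : nat) (x : 'rV_n.+2) i : sqn (row i (circ x)) = sqn x.
Proof.
rewrite /sqn [RHS](reindex_inj (addIr (- i))) /=.
by apply: eq_bigr => j _; rewrite !mxE.
Qed.

(** Shifting the summation index by one moves the rotation onto the coefficients; this makes [cyc x]
    cyclic. *)
Lemma rotv_mul_circ (n : nat) (x c : 'rV_n.+2) :
  rotv (c *m circ x) = rotv c *m circ x.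
Proof.
apply/rowP => j; rewrite !mxE [RHS](reindex_inj (addIr 1)) /=.
apply: eq_bigr => i _; rewrite !mxE -!(@sub_Zp_1 n.+2) addrK.
by congr (_ * x _ _); rewrite opprD addrA addrAC.
Qed.

(** The factor 5 leaves a margin over the [4 N t] subtracted in the comparison behind [sqn_circ_lt],
    where [N = n.+2]. *)
Definition dominated (n : nat) (t : int) (x : 'rV[int]_n.+2) : Prop :=
  [/\ 0 < t, (5 * n.+2)%:Z * t <= x ord0 0 &
     forall j, j != 0 -> `|x ord0 j| <= t].

Lemma sqn_mul_circ_ge (n : nat) (t : int) (x c : 'rV_n.+2) :
  dominated t x ->
  x ord0 0 * (x ord0 0 - (2 * n.+2)%:R * t) * sqn c <= sqn (c *m circ x).
Proof.
move=> [t0 xt xj]; apply: sqr_mulmx_ge; first exact: ltW.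
- by apply: le_trans xt; nia.
- by move=> i; rewrite mxE subrr.
- by move=> i j ij; rewrite mxE xj // subr_eq0 eq_sym.
Qed.

Lemma sqn_dominated (n : nat) (t : int) (x : 'rV_n.+2) :
  dominated t x ->
  sqn x <= x ord0 0 ^+ 2 + n.+1%:Z * t ^+ 2.
Proof.
move=> [t0 xt xj]; rewrite /sqn (bigD1 0) //= lerD2l.
have -> : n.+1%:Z * t ^+ 2 = \sum_(j < n.+2 | j != 0) t ^+ 2.
  by rewrite sumr_const cardC1 card_ord -mulr_natl natz.
apply: ler_sum => j j0; rewrite -real_normK ?num_real //.
by rewrite lerXn2r ?nnegrE ?xj // ltW.
Qed.

Lemma sqn_circ_lt (n : nat) (t : int) (x c : 'rV_n.+2) :
  dominated t x -> 2 <= sqn c -> sqn x < sqn (c *m circ x).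
Proof.
move=> dx c2; apply: lt_le_trans (sqn_mul_circ_ge c dx).
apply: le_lt_trans (sqn_dominated dx) _.
case: dx => t0 xt _; set m := x ord0 0 in xt *.
have m0 : 0 <= m - (2 * n.+2)%:R * t by rewrite natz; nia.
apply: lt_le_trans (ler_wpM2l _ c2); last by apply: mulr_ge0 => //; nia.
(* With [N = n.+2], [2 m (m - 2 N t) - m^2 = m (m - 4 N t) >= 5 N^2 t^2 > (N - 1) t^2]. *)
nia.
Qed.

(** * The lattice generated by the rotations of a vector *)

(** Reading [x] as the polynomial with coefficients [x_j], this is the principal ideal of [x] in
    Z[X]/(X^N - 1), with [N = n.+2]. *)
Definition cyc (n : nat) (x : 'rV[int]_n.+2) : set 'rV[int]_n.+2 :=
  [set c *m circ x | c in [set: 'rV_n.+2]].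

Lemma cyc_row (n : nat) (x : 'rV_n.+2) i : cyc x (row i (circ x)).
Proof. by exists (delta_mx ord0 i) => //; rewrite -rowE. Qed.

Lemma row0_circ (n : nat) (x : 'rV_n.+2) : row 0 (circ x) = x.
Proof. by apply/rowP => j; rewrite !mxE subr0. Qed.

Lemma cyc_sublattice (n : nat) (x : 'rV_n.+2) : sublattice (cyc x).
Proof.
split; first by exists 0 => //; rewrite mul0mx.
by move=> _ _ [c _ <-] [d _ <-]; exists (c - d) => //; rewrite mulmxBl.
Qed.

Lemma cyc_cyclic (n : nat) (x : 'rV_n.+2) : cyclic_lattice (cyc x).
Proof.
apply/seteqP; split => [_ [_ [c _ <-] <-]|_ [c _ <-]].
  by exists (rotv c) => //; rewrite rotv_mul_circ.
pose c' : 'rV[int]_n.+2 := \row_j c ord0 (ordS j).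
have cc : rotv c' = c by apply/rowP => j; rewrite !mxE ord_predK.
by exists (c' *m circ x); [exists c' | rewrite rotv_mul_circ cc].
Qed.

Lemma zspan_sub (n : nat) (L S : set 'rV[int]_n) :
  sublattice L -> S `<=` L -> zspan S `<=` L.
Proof.
move=> [L0 LB] SL _ [k [c [v [Sv ->]]]].
have LN y : L y -> L (- y) by move=> Ly; rewrite -sub0r; apply: LB.
have LD y z : L y -> L z -> L (y + z).
  by move=> Ly Lz; rewrite -[z]opprK; apply: LB => //; apply: LN.
have LM y m : L y -> L (y *+ m).
  by move=> Ly; elim: m => [//|m IH]; rewrite mulrS; apply: LD.
apply: big_ind => // i _; rewrite -[c i]intz scaler_int.
by case: (c i) => m; rewrite ?NegzE ?mulrNz; [|apply: LN]; apply/LM/SL/Sv.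
Qed.

(** * Minimal vectors and successive minima for dominated [x] *)

Section Dominated.
Variables (R : realType) (n : nat) (t : int) (x : 'rV[int]_n.+2).
Hypothesis dx : dominated t x.

(** For a real kernel vector [c], the norm bound makes a positive multiple of the sum of the [c_i^2]
    at most 0. *)
Lemma row_free_circ : row_free (real_mx R (circ x)).
Proof.
have [t0 xt xj] := dx.
apply: inj_row_free => c c0.
have sum0 : \sum_j (c *m real_mx R (circ x)) ord0 j ^+ 2 = 0.
  by rewrite c0 big1 // => j _; rewrite mxE expr0n.
have := @sqr_mulmx_ge R _ (real_mx R (circ x)) (x ord0 0)%:~R t%:~R c.
rewrite sum0 => H.
have : (x ord0 0 : int)%:~R * (((x ord0 0 : int)%:~R : R)
    - (2 * n.+2)%:R * t%:~R) * (\sum_i c ord0 i ^+ 2) <= 0.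
  apply: H.
  - by rewrite ler0z ltW.
  - by rewrite ler0z; apply: le_trans xt; nia.
  - by move=> i; rewrite !mxE subrr.
  - move=> i j ij; rewrite !mxE -intr_norm ler_int.
    by rewrite xj // subr_eq0 eq_sym.
rewrite pmulr_rle0.
  move=> s0; apply/rowP => j; rewrite mxE; apply/eqP; rewrite -sqrf_eq0.
  have sq0 (i : 'I_n.+2) : true -> 0 <= c ord0 i ^+ 2 by rewrite sqr_ge0.
  apply/eqP; apply: (psumr_eq0P sq0) => //.
  by apply: le_anti; rewrite s0 sumr_ge0.
rewrite pmulrn -!(intrM, intrB) ltr0z.
nia.
Qed.

(** Coefficients with [sqn c < 2] give 0 or a signed rotation, as long as [x]; all others give
    strictly longer vectors. *)
Lemma sqn_min_cyc (y : 'rV_n.+2) : cyc x y -> y != 0 -> sqn x <= sqn y.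
Proof.
move=> [c _ <-] y0; have [/sqn_lt2|] := ltP (sqn c) 2.
  case=> [c0|[b [i c0]]]; first by rewrite c0 mul0mx eqxx in y0.
  suff -> : sqn (c *m circ x) = sqn x by [].
  rewrite c0 -scalemxAl -rowE -(sqn_row_circ x i) /sqn.
  by apply: eq_bigr => j _; rewrite mxE exprMn sqrr_sign mul1r.
by move=> c2; apply/ltW/(sqn_circ_lt dx).
Qed.

Lemma cyc_independent : independent_in R (cyc x) (circ x).
Proof. by split; [exact: cyc_row | exact: row_free_circ]. Qed.

Lemma dominated_neq0 : x != 0.
Proof.
have [t0 xt _] := dx; apply/eqP => x0; move: xt.
by rewrite x0 mxE; nia.
Qed.

Lemma succ_min1_cyc : succ_min R 1 (cyc x) = znorm R x.
Proof.
rewrite /succ_min; set E := [set _ | _].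
have Ex : E (znorm R x).
  split; first exact: znorm_ge0.
  (* The row vector [x] itself serves as the one-row matrix, so the infimum is attained. *)
  exists x; split; last by move=> i; rewrite row_id.
  split.
    by move=> i; rewrite row_id -[x in cyc _ x]row0_circ; apply: cyc_row.
  apply: inj_row_free => v vx.
  have : (v ord0 ord0) *: real_mx R x = 0.
    by rewrite -mul_scalar_mx -mx11_scalar.
  move/eqP; rewrite scaler_eq0 => /orP[/eqP v0|/eqP x0].
    by apply/rowP => j; rewrite ord1 mxE.
  case/negP: dominated_neq0; apply/eqP/rowP => j.
  move/rowP: x0 => /(_ j); rewrite !mxE => /eqP.
  by rewrite intr_eq0 => /eqP.
have lbE : lbound E (znorm R x).
  move=> s [s0 [B [[LB Bf] Bs]]]; apply: le_trans (Bs ord0).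
  rewrite ler_znorm; apply: sqn_min_cyc => //.
  (* A zero row would send the 1 by 1 matrices 1 and 0 to the same product, against row-freeness. *)
  apply/eqP => B0; have /negP[] := oner_neq0 R.
  have /(congr1 (fun A : 'M[R]_1 => A ord0 ord0)) : (1%:M : 'M[R]_1) = 0.
    apply: (row_free_inj Bf); rewrite mul1mx mul0mx.
    apply/matrixP => i j; rewrite ord1 !mxE.
    by move/rowP: B0 => /(_ j); rewrite !mxE => ->.
  by rewrite !mxE eqxx => /eqP.
by apply: le_anti; rewrite ge_inf ?lb_le_inf //; exists (znorm R x).
Qed.

Lemma min_vectors_cyc_row i : min_vectors R (cyc x) (row i (circ x)).
Proof.
by split; [exact: cyc_row | rewrite succ_min1_cyc !znormE sqn_row_circ].
Qed.

Lemma cyc_WR' : WR' R (cyc x).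
Proof.
apply/seteqP; split => [_ [c _ <-]|].
  exists n.+2, (c ord0), (fun i => row i (circ x)); split.
    exact: min_vectors_cyc_row.
  exact: mulmx_sum_row.
by apply: zspan_sub; [exact: cyc_sublattice | move=> y []].
Qed.

Lemma cyc_cyclic_lattice : cyclic_lattices R (cyc x).
Proof.
split; first exact: cyc_sublattice.
  by exists (circ x); exact: cyc_independent.
exact: cyc_cyclic.
Qed.

Lemma succ_min_cyc_le : succ_min R n.+2 (cyc x) <= znorm R x.
Proof.
apply: ge_inf; first by exists 0 => s [].
split; first exact: znorm_ge0.
exists (circ x); split; first exact: cyc_independent.
by move=> i; rewrite ler_znorm sqn_row_circ.
Qed.

End Dominated.

(** * The lattice determines its dominated generator *)

(** Both generators have length [succ_min R 1], so [y] is a signed rotation of [x]; its entry in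
    position 0 then fixes the rotation and the sign. *)
Lemma cyc_inj (R : realType) (n : nat) (t : int) (x y : 'rV_n.+2) :
  dominated t x -> dominated t y -> cyc x = cyc y -> x = y.
Proof.
move=> dx dy xy.
have: znorm R x = znorm R y.
  by rewrite -(succ_min1_cyc R dx) xy (succ_min1_cyc R dy).
have: cyc x y by rewrite xy -{2}[y]row0_circ; apply: cyc_row.
case=> c _ yE xyn.
have sxy : sqn y <= sqn x by rewrite -(ler_znorm R) xyn.
have /sqn_lt2[c0|[b [i ci]]] : sqn c < 2.
- rewrite ltNge; apply/negP => /(sqn_circ_lt dx).
  by rewrite yE ltNge sxy.
- by have := dominated_neq0 dy; rewrite -yE c0 mul0mx eqxx.
have [t0 xt xj] := dx; have [_ yt _] := dy.
have yi j : y ord0 j = (-1) ^+ b * x ord0 (j - i).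
  by rewrite -yE ci -scalemxAl -rowE !mxE.
(* Otherwise [y_0] would be, up to sign, an entry of [x] off position 0, of size at most [t], yet
   [y_0 >= 5 N t]. *)
have i0 : i = 0.
  apply/eqP/negPn/negP => i0; have := xj (0 - i).
  rewrite sub0r oppr_eq0 => /(_ i0).
  have := yi 0; rewrite sub0r => E.
  have := yt; rewrite E; case: b {E ci yi} => /=; nia.
move: ci yi; rewrite {}i0 => _ yi.
have b0 : b = false.
  case: b yi => // yi; have := yi 0; rewrite subr0 expr1; nia.
by apply/rowP => j; rewrite yi b0 subr0 expr0 mul1r.
Qed.

(** * Finiteness of the counted set *)

Lemma row_free_row (K : fieldType) (m n : nat) (A : 'M[K]_(m, n)) i :
  row_free A -> row_free (row i A).
Proof.
move=> fA; apply: inj_row_free => v.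
rewrite rowE mulmxA => vA; have v0 : v *m delta_mx ord0 i = 0.
  by apply: (row_free_inj fA); rewrite vA mul0mx.
apply/rowP => j; rewrite ord1; move/rowP: v0 => /(_ i).
by rewrite !mxE big_ord1 mxE !eqxx mulr1.
Qed.

Lemma succ_min1_le (R : realType) (n : nat) (L : set 'rV[int]_n.+1) :
  full_rank R L -> succ_min R 1 L <= succ_min R n.+1 L.
Proof.
move=> [B [LB fB]]; apply: lb_le_inf.
  (* Full rank makes the set under the larger infimum nonempty; an empty one would give the default
     value 0. *)
  exists (\sum_i znorm R (row i B)); split.
    by apply: sumr_ge0 => i _; apply: znorm_ge0.
  exists B; split => // i; rewrite (bigD1 i) //= lerDl.
  by apply: sumr_ge0 => j _; apply: znorm_ge0.
move=> s [s0 [C [[LC fC] Cs]]]; apply: ge_inf; first by exists 0 => u [].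
split=> //; exists (row 0 C); split; last by move=> i; rewrite row_id.
split; first by move=> i; rewrite row_id.
by rewrite /real_mx map_row row_free_row.
Qed.

Lemma le_norm_znorm (R : realType) (n : nat) (x : 'rV[int]_n) j :
  `|x ord0 j|%:~R <= znorm R x.
Proof.
rewrite znormE intr_norm -sqrtr_sqr ler_wsqrtr // -rmorphXn ler_int.
rewrite /sqn (bigD1 j) //= lerDl.
by apply: sumr_ge0 => i _; apply: sqr_ge0.
Qed.

(** A WR' lattice is recovered from its minimal vectors, whose entries have absolute value at most
    [M]; a finite box has finitely many subsets. *)
Lemma finite_WR' (R : realType) (n : nat) (r : R) :
  finite_set [set L : set 'rV[int]_n.+1 |
    [/\ cyclic_lattices R L, succ_min R n.+1 L <= r & WR' R L]].
Proof.
pose M := Num.trunc r.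
(* The offset turns indices from 0 to [2 M] into entries from [-M] to [M]. *)
pose emb (f : {ffun 'I_n.+1 -> 'I_(2 * M).+1}) : 'rV[int]_n.+1 :=
  \row_j ((f j)%:Z - M%:Z).
pose F (A : {set {ffun 'I_n.+1 -> 'I_(2 * M).+1}}) : set 'rV[int]_n.+1 :=
  zspan [set emb f | f in [set` A]].
apply: (@sub_finite_set _ _ [set F A | A in setT]); last first.
  exact/finite_image/finite_finset.
move=> L [[_ fL _] Lr LW].
exists (finset (fun f => `[< min_vectors R L (emb f) >])) => //.
rewrite /F [RHS]LW; congr zspan; apply/seteqP; split => [_ [f /= fA <-]|x xL].
  by move: fA; rewrite inE => /asboolP.
have xM j : `|x ord0 j| <= M%:Z.
  have : `|x ord0 j|%:~R <= r.
    apply: le_trans (le_norm_znorm R x j) _; rewrite xL.2.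
    exact: le_trans (succ_min1_le fL) Lr.
  rewrite -[ `|x ord0 j| ]gez0_abs // lez_nat => xr.
  by rewrite truncn_ge_nat // (le_trans _ xr).
pose f := [ffun j : 'I_n.+1 => inord (absz (x ord0 j + M%:Z)) : 'I_(2 * M).+1].
have fx : emb f = x.
  apply/rowP => j; rewrite mxE ffunE; have := xM j.
  move: (x ord0 j) => u uM; rewrite inordK.
    lia.
  lia.
by exists f => //=; rewrite inE; apply/asboolP; rewrite fx.
Qed.

(** * Counting the lattices *)

Definition near_axis (n t : nat) (f : {ffun 'I_n.+2 -> 'I_t}) : 'rV[int]_n.+2 :=
  \row_j ((5 * n.+2 * t * (j == 0%R) + f j)%N)%:Z.

Lemma near_axis_inj (n t : nat) : injective (@near_axis n t).
Proof.
move=> f g /rowP fg; apply/ffunP => j; apply/val_inj => /=.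
by move: (fg j); rewrite !mxE; lia.
Qed.

Lemma near_axis_dominated (n t : nat) (f : {ffun 'I_n.+2 -> 'I_t}) :
  (0 < t)%N -> dominated t%:Z (near_axis f).
Proof.
move=> t0; split; first by rewrite ltz_nat.
  by rewrite mxE eqxx; nia.
move=> j /negPf j0; rewrite mxE j0; have := ltn_ord (f j); lia.
Qed.

(** Entries are at most [(5 N + 1) t <= 6 N t], where [N = n.+2]; bounding the number [N] of entries
    by [N^2] keeps the root an integer: [N (6 N t)^2 <= (6 N^2 t)^2]. *)
Lemma znorm_near_axis (R : realType) (n t : nat) (f : {ffun 'I_n.+2 -> 'I_t}) :
  znorm R (near_axis f) <= (6 * n.+2 ^ 2 * t)%:R.
Proof.
rewrite znormE -[leRHS]ger0_norm ?ler0n // -sqrtr_sqr ler_wsqrtr //.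
rewrite -natrX pmulrn ler_int.
have bd j : true -> near_axis f ord0 j ^+ 2 <= ((6 * n.+2 * t) ^ 2)%N%:Z.
  move=> _; rewrite mxE -natz -natrX natz lez_nat leq_exp2r //.
  by have := ltn_ord (f j); case: (j == 0); nia.
apply: le_trans (ler_sum _ bd) _.
rewrite sumr_const card_ord -mulr_natl natz -PoszM lez_nat.
by rewrite !expnMn; nia.
Qed.

Lemma card_WR'_ge (R : realType) (n t : nat) (r : R) :
  (0 < t)%N -> (6 * n.+2 ^ 2 * t)%:R <= r ->
  (t ^ n.+2 <= #|` fset_set [set L : set 'rV[int]_n.+2 |
     [/\ cyclic_lattices R L, (succ_min R n.+2 L <= r)%R & WR' R L]] |)%N.
Proof.
move=> t0 tr.
have -> : (t ^ n.+2)%N =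
    size [seq cyc (near_axis f) | f <- enum {ffun 'I_n.+2 -> 'I_t}].
  by rewrite size_map -cardE card_ffun !card_ord.
apply: uniq_leq_size.
  rewrite map_inj_uniq ?enum_uniq // => f g fg; apply/near_axis_inj.
  by apply: (@cyc_inj R _ t%:Z) fg; apply: near_axis_dominated.
move=> _ /mapP[f _ ->]; have df := near_axis_dominated f t0.
(* Membership in [fset_set] reduces to the set itself because that set is finite. *)
rewrite in_fset_set; last exact: finite_WR'.
rewrite inE; split; [exact: cyc_cyclic_lattice df | | exact: cyc_WR' df].
apply: le_trans (succ_min_cyc_le R df) _.
exact: le_trans (znorm_near_axis R f) tr.
Qed.

(* [fset_set] of an infinite set is empty, so the bound also forces the set
   being counted to be finite. *)
Theorem theorem1p1 (R : realType) (N : nat) (hN : (2 <= N)%N) :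
  exists alpha : R, 0 < alpha /\
    exists r0 : R, forall r : R, r0 <= r ->
      alpha * r ^+ N <=
        (#|` fset_set [set L : set 'rV[int]_N |
               [/\ cyclic_lattices R L, succ_min R N L <= r & WR' R L]] |)%:R.
Proof.
case: N hN => [|[|n]] // _.
pose K : R := (6 * n.+2 ^ 2)%:R.
have K0 : 0 < K by rewrite ltr0n.
exists ((2 * K) ^- n.+2); split.
  by rewrite invr_gt0 exprn_gt0 // mulr_gt0.
(* From [r >= 2 K] follows [r / K >= 2], hence [t > r / K - 1 >= r / (2 K)]; this is where the
   factor 2 in [alpha] comes from. *)
exists (2 * K) => r Kr; set t := Num.trunc (r / K).
have rK : 2 <= r / K by rewrite ler_pdivlMr.
have rK0 : 0 <= r / K by apply: le_trans rK.
have /andP[tr rt] := truncn_itv rK0; rewrite -/t in tr rt.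
have t0 : (0 < t)%N by rewrite truncn_gt0 (le_trans _ rK) // ler1n.
apply: le_trans (_ : (t ^ n.+2)%:R <= _); last first.
  rewrite ler_nat; apply: card_WR'_ge => //.
  by rewrite natrM mulrC -ler_pdivlMr.
have rE : (2 * K)^-1 * r = r / K / 2 by rewrite invfM; ring.
rewrite -exprVn -exprMn natrX rE lerXn2r ?nnegrE ?divr_ge0 //.
  by apply: le_trans Kr; rewrite mulr_ge0 // ltW.
by move: rK rt; rewrite -[t.+1%:R]natr1; move: (r / K) => u; lra.
Qed.
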